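(* Let $(\gamma_j)_{j\ge1}$ be non-negative real numbers, and let $\gamma$ be the corresponding product weights $\gamma_{\mathfrak{u}}=\prod_{j\in\mathfrak{u}}\gamma_j$ for non-empty finite $\mathfrak{u}\subset\mathbb{N}=\{1,2,\dots\}$. Assume that $$ \sum_{j=1}^\infty e^{-c \gamma_j^{-2}} < \infty $$ for some $c>0$. Then there is a constant $C_\gamma$ such that for any $N \geq 1$ and $d \geq 1$ there exist points $x_1, \dots, x_N \in [0,1]^d$ for which $$ D_{N,\gamma}^* (x_1, \dots, x_N) \leq \frac{C_\gamma}{\sqrt{N}}. $$ Consequently, the weighted star-discrepancy for such weights is strongly tractable, with $\varepsilon$-exponent at most $2$.
   Context: The term $e^{-c\gamma_j^{-2}}$ is read as $0$ when $\gamma_j=0$. Points in a point set $x_1,\dots,x_N$ are counted with multiplicity. For $x_1,\dots,x_N\in[0,1]^d$ and $z=(z_1,\dots,z_d)\in[0,1]^d$, the discrepancy function is $$\Delta(z)=\frac1N\sum_{n=1}^N \mathbf{1}_{[0,z)}(x_n)-\lambda([0,z)),$$ where $[0,z)=\prod_{i=1}^d[0,z_i)$ and $\lambda$ is $d$-dimensional Lebesgue measure. For a non-empty subset $\mathfrak{u}\subset\{1,\dots,d\}$, $(z(\mathfrak{u});1)$ denotes the point of $[0,1]^d$ obtained from $z$ by replacing every coordinate whose index is not in $\mathfrak{u}$ by $1$. The weighted star-discrepancy is $$D_{N,\gamma}^*(x_1,\dots,x_N)=\sup_{z\in[0,1]^d}\ \max_{\emptyset\ne\mathfrak{u}\subset\{1,\dots,d\}}\gamma_{\mathfrak{u}}\,|\Delta(z(\mathfrak{u});1)|.$$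 $n_\gamma^*(d,\varepsilon)$ denotes the smallest possible cardinality of a set of points from $[0,1]^d$ whose weighted star-discrepancy with respect to $\gamma$ is at most $\varepsilon$. The weighted star-discrepancy (for given weights $\gamma$) is called strongly tractable if there exist non-negative constants $C,\beta$ such that $n_\gamma^*(d,\varepsilon)\le C\varepsilon^{-\beta}$ for all $d\ge1$ and $\varepsilon\in(0,1)$; in that case the infimum of the $\beta$ for which this holds (with some $C$) is called the $\varepsilon$-exponent of strong tractability. *)

(* Defs.v *)
From HB Require Import structures.
From mathcomp Require Import all_boot all_order all_algebra.
From mathcomp Require Import all_classical all_reals all_analysis.
From mathcomp Require Import measurable_realfun.
Set Implicit Arguments.
Unset Strict Implicit.
Unset Printing Implicit Defensive.
Import Order.TTheory GRing.Theory Num.Theory.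
Import numFieldNormedType.Exports.
Local Open Scope classical_set_scope.
Local Open Scope ring_scope.

(* Coordinates are numbered from 0: [gamma j] is the weight usually written
   gamma_(j+1), and a set of coordinates is a [u : {set 'I_d}]. *)

Definition unit_cube (R : realType) (d : nat) : set (d.-tuple R) :=
  [set z | forall i, 0 <= tnth z i <= 1].

Definition box0 (R : realType) (d : nat) (z : d.-tuple R) : set (d.-tuple R) :=
  [set y | forall i, 0 <= tnth y i < tnth z i].

(* d-dimensional Lebesgue measure, as the iterated product of the
   one-dimensional one: the measure of A is the integral over t of the
   (d-1)-dimensional measure of the section of A at first coordinate t. *)
Fixpoint lebesgue_n (R : realType) (d : nat) : set (d.-tuple R) -> \bar R :=
  match d with
  | 0 => fun A => \d_([tuple] : 0.-tuple R) A
  | d'.+1 => fun A =>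
      (\int[@lebesgue_measure R]_t
         lebesgue_n [set s : d'.-tuple R | A [tuple of t :: s]])%E
  end.

Lemma lebesgue_n_box0 (R : realType) (d : nat) (z : d.-tuple R) :
  unit_cube z -> lebesgue_n (box0 z) = (\prod_(i < d) tnth z i)%:E.
Proof.
have l0 n : lebesgue_n (set0 : set (n.-tuple R)) = 0%E.
  elim: n => [|n IHn] /=; first exact: measure0.
  under eq_integral do rewrite (_ : [set _ | _] = set0) ?IHn//.
  exact: integral0.
elim: d z => [|d IHd] z z01.
  rewrite big_ord0 /= diracE mem_set//.
  by case.
case/tupleP: z z01 => a z z01.
have a01 : 0 <= a <= 1 by have := z01 ord0; rewrite tnth0.
have z01' : unit_cube z.
  by move=> i; have := z01 (lift ord0 i); rewrite tnthS.
rewrite big_ord_recl tnth0.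
under eq_bigr do rewrite tnthS.
rewrite /=.
rewrite (_ : (fun t => _) =
    (fun t => (\prod_(i < d) tnth z i)%:E * (\1_(`[0, a[%classic : set R) t)%:E)%E).
  rewrite ge0_integralZl//=; last 2 first.
  - by apply/measurable_EFinP; exact: measurable_indic.
  - by rewrite lee_fin prodr_ge0// => i _; have /andP[] := z01' i.
  rewrite integral_indic// setIT.
  have mu_a : @lebesgue_measure R `[0, a[%classic = a%:E.
    rewrite lebesgue_measure_itv/= lte_fin oppr0 adde0.
    case: ltP => // a0; congr EFin; apply/eqP; rewrite eq_le a0.
    by case/andP: a01 => ->.
  rewrite mulrC EFinM -mu_a; congr (_ * _)%E.
apply/funext => t; rewrite indicE.
case: (boolP (t \in _)) => [|tn].
  rewrite inE/= in_itv/= => ta; rewrite mule1 -IHd//; congr lebesgue_n.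
  apply/seteqP; split => s /= H i.
    by have := H (lift ord0 i); rewrite !tnthS.
  by case: (unliftP ord0 i) => [j|] ->; rewrite ?tnthS ?tnth0.
rewrite mule0 (_ : [set _ | _] = set0) ?l0//.
apply/seteqP; split => // s /= /(_ ord0); rewrite !tnth0 => ta.
by move: tn; rewrite notin_setE/= in_itv/=.
Qed.

Definition local_discrepancy (R : realType) (d N : nat)
    (x : 'I_N -> d.-tuple R) (z : d.-tuple R) : R :=
  N%:R^-1 * \sum_(n < N) \1_(box0 z) (x n) - fine (lebesgue_n (box0 z)).

(* the point (z(u); 1) *)
Definition fill1 (R : realType) (d : nat) (u : {set 'I_d}) (z : d.-tuple R) :
    d.-tuple R :=
  [tuple if i \in u then tnth z i else 1 | i < d].

Definition product_weight (R : realType) (gamma : nat -> R) (d : nat)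
    (u : {set 'I_d}) : R :=
  \prod_(j in u) gamma j.

(* The default 0 of the maximum is immaterial: all terms are nonnegative when
   gamma is, and there is at least one as soon as 0 < d. *)
Definition weighted_star_discrepancy (R : realType) (gamma : nat -> R)
    (d N : nat) (x : 'I_N -> d.-tuple R) : \bar R :=
  ereal_sup [set (\big[Num.max/0]_(u : {set 'I_d} | u != finset.set0)
                    (product_weight gamma u *
                     `|local_discrepancy x (fill1 u z)|))%:E
            | z in @unit_cube R d].

(* Infimum of a set of positive integers, hence the least of them, or +oo if
   there is none. Points are counted with multiplicity. *)
Definition inverse_discrepancy (R : realType) (gamma : nat -> R) (d : nat)
    (eps : R) : \bar R :=
  ereal_inf [set N%:R%:E | N in [set N : nat | (0 < N)%N /\
    exists x : 'I_N -> d.-tuple R, (forall n, unit_cube (x n)) /\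
      (weighted_star_discrepancy gamma x <= eps%:E)%E]].

Definition tractability_bound (R : realType) (gamma : nat -> R) (C beta : R) :
    Prop :=
  forall (d : nat) (eps : R), (0 < d)%N -> 0 < eps < 1 ->
    (inverse_discrepancy gamma d eps <= (C * eps `^ (- beta))%:E)%E.

Definition strongly_tractable (R : realType) (gamma : nat -> R) : Prop :=
  exists C beta : R, [/\ 0 <= C, 0 <= beta & tractability_bound gamma C beta].

Definition strong_tractability_exponent (R : realType) (gamma : nat -> R) :
    \bar R :=
  ereal_inf [set beta%:E | beta in [set beta : R | 0 <= beta /\
    exists C : R, 0 <= C /\ tractability_bound gamma C beta]].

(* exp (- c g^-2), read as 0 when g = 0 *)
Definition exp_neg_inv_sqr (R : realType) (c g : R) : R :=
  if g == 0 then 0 else expR (- (c * g ^- 2)).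

(* Main.v *)
(* Idea. Starting from many copies of a fine grid, the number of points is
   halved until N are left: the points are paired and one point of each pair is
   kept, according to a vector e of random signs. Halving 2m points changes the
   counts in the boxes by signed sums of the e_i over the points below a corner
   z. In each coordinate the sets {x_j < v} form a chain, so Levy's maximal
   inequality, applied once per coordinate of u, bounds the number of sign
   vectors for which some box [0, (z(u); 1)) has a sum exceeding t by 2^|u|
   times the number of those with |e_1 + ... + e_m| > t, a sub-Gaussian tail.
   With t = C sqrt(m) / gamma_u the union bound over all u is a sum of
   2^|u| exp(- C^2 / (8 gamma_u^2)), which is small uniformly in d for large C.
   One halving thus costs C / sqrt(m), and these costs form a geometric series
   dominated by its last term, of order C / sqrt(N). *)
Require Import Defs.
From mathcomp Require Import all_boot all_order all_algebra.
From mathcomp Require Import all_classical all_reals all_analysis.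
From mathcomp Require Import lra ring.
Import Order.TTheory GRing.Theory Num.Theory.
Import numFieldNormedType.Exports.
Local Open Scope classical_set_scope.
Local Open Scope ring_scope.

(** * Signed sums and Levy's maximal inequality along a chain *)

Definition sign_sum (R : realType) {T : finType} (e : {ffun T -> bool})
    (A : {set T}) : R :=
  \sum_(i in A) (-1) ^+ e i.

Definition large_signs {R : realType} {T : finType} (t : R)
    (F : {set {set T}}) : {set {ffun T -> bool}} :=
  [set e | [exists A in F, t < `|sign_sum R e A|]]%SET.

Definition flip_outside {T : finType} (B : {set T}) (e : {ffun T -> bool}) :
    {ffun T -> bool} :=
  [ffun i => if i \in B then e i else ~~ e i].

Lemma flip_outsideK {T : finType} (B : {set T}) :
  involutive (flip_outside B).
Proof.
move=> e; apply/ffunP => i; rewrite !ffunE.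
by case: (i \in B); rewrite ?negbK.
Qed.

(** Signs outside [B] cancel, and those inside [B] double. *)
Lemma sign_sum_flip (R : realType) {T : finType} (A B : {set T})
    (e : {ffun T -> bool}) :
  sign_sum R e A + sign_sum R (flip_outside B e) A =
  2 * sign_sum R e (A :&: B)%SET.
Proof.
rewrite /sign_sum -big_split/= mulr_sumr.
rewrite (big_setID B)/= [X in _ + X]big1 ?addr0.
  apply: eq_bigr => i; rewrite inE => /andP[_ iB].
  by rewrite ffunE iB mulr2n mulrDl mul1r.
move=> i; rewrite inE => /andP[/negPf iB _].
by rewrite ffunE iB; case: (e i); rewrite /= ?expr0 ?expr1; lra.
Qed.

Lemma eq_sign_sum_flip (R : realType) {T : finType} (A B : {set T})
    (e : {ffun T -> bool}) :
  A \subset B -> sign_sum R (flip_outside B e) A = sign_sum R e A.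
Proof.
by move=> /fintype.subsetP AB; apply: eq_bigr => i /AB iB; rewrite ffunE iB.
Qed.

Definition chain {T : finType} (C : {set {set T}}) :=
  {in C &, forall A B : {set T}, (A \subset B) || (B \subset A)}.

(* Levy's reflection argument: flipping the signs outside the first member of
   the chain that carries a large sum is injective, and it cannot leave the
   total sum small both before and after. *)
Lemma card_large_signs_chain {R : realType} {T : finType} (t : R)
    (F C : {set {set T}}) :
  chain C ->
  (#|large_signs t [set A :&: B | A in F, B in C]%SET| <=
   2 * #|large_signs t F|)%N.
Proof.
move=> chC.
pose hit e B := (B \in C) && [exists A in F, t < `|sign_sum R e (A :&: B)%SET|].
(* In a chain, a hit of least cardinality is contained in every other hit. The default [finset.set0]
   arises only without any hit, hence never in [D]. *)
pose first e := if [pick B | hit e B] is Some B0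
  then [arg min_(B < B0 | hit e B) #|B|]%N else finset.set0.
set D := large_signs t _.
have hitE e : e \in D -> exists B, hit e B.
  rewrite inE => /exists_inP[_ /imset2P[A B AF BC ->] tAB].
  by exists B; rewrite /hit BC/=; apply/exists_inP; exists A.
have firstP e : e \in D -> hit e (first e) /\
    forall B, hit e B -> (#|first e| <= #|B|)%N.
  move=> /hitE[B1 hB1]; rewrite /first; case: pickP => [B0 hB0|/(_ B1)].
    by case: arg_minnP.
  by rewrite hB1.
pose tau e := flip_outside (first e) e.
have hit_flip e (B0 B : {set T}) : B \subset B0 -> hit (flip_outside B0 e) B = hit e B.
  move=> BB0; rewrite /hit; congr (_ && _); apply: eq_existsb => A.
  by rewrite eq_sign_sum_flip// (fintype.subset_trans _ BB0)// subsetIr.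
have first_tau e : e \in D -> tau e \in D /\ first (tau e) = first e.
  move=> eD; have [h1 h2] := firstP e eD.
  have h3 : hit (tau e) (first e) by rewrite hit_flip.
  have tD : tau e \in D.
    rewrite inE; have /andP[fC /exists_inP[A AF tA]] := h3.
    by apply/exists_inP; exists (A :&: first e)%SET => //; apply: imset2_f.
  split=> //; have [k1 k2] := firstP _ tD.
  (* Both sets are hits of [tau e], so the chain order and minimality put [first (tau e)] inside
     [first e]. By [hit_flip] it is then a hit of [e] too, and minimality for [e] forces
     equality. *)
  have le1 := k2 _ h3.
  have /andP[c1 _] := h1; have /andP[c2 _] := k1.
  have sub : first (tau e) \subset first e.
    have /orP[//|sub] := chC _ _ c2 c1.
    have/eqP -> : first e == first (tau e) by rewrite eqEcard sub le1.
    by [].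
  apply/eqP; rewrite eqEcard sub /=; apply: h2.
  by rewrite -(hit_flip e (first e))//.
have tauK : {in D, cancel tau tau}.
  move=> e eD; rewrite /tau -/(tau e) (first_tau e eD).2.
  exact: flip_outsideK.
have DG : D \subset (large_signs t F :|: tau @^-1: large_signs t F)%SET.
  apply/fintype.subsetP => e eD; have [/andP[fC /exists_inP[A AF tA]] _] := firstP e eD.
  rewrite !inE; apply/orP.
  have := sign_sum_flip R A (first e) e; rewrite -/(tau e) => E.
  case: (ltP t `|sign_sum R e A|) => [h|h].
    by left; apply/exists_inP; exists A.
  right; apply/exists_inP; exists A => //.
  rewrite ltNge; apply/negP => h'.
  have : `|2 * sign_sum R e (A :&: first e)%SET| <= t + t.
    by rewrite -E (le_trans (ler_normD _ _))// lerD.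
  by rewrite normrM ger0_norm// leNgt => /negP; apply; lra.
have -> : D = ((D :&: large_signs t F) :|:
    (D :&: tau @^-1: large_signs t F))%SET.
  by rewrite -finset.setIUr; apply/esym/finset.setIidPl.
rewrite mul2n -addnn (leq_trans (leq_card_setU _ _).1)// leq_add//.
  by rewrite subset_leq_card// subsetIr.
rewrite -(card_in_imset (f := tau)).
  apply/subset_leq_card/fintype.subsetP => _ /imsetP[e + ->].
  by rewrite !inE => /andP[_].
move=> e e' /finset.setIP[eD _] /finset.setIP[eD' _].
exact: (can_in_inj tauK eD eD').
Qed.

(** * The sub-Gaussian tail of a full sum of signs *)

(** For [x] at least 1/2 both exponents are at most [2 * x ^+ 2]. For [x] in [0, 1/2) the bound
    [expR y <= (1 - y)^-1], used at [x] and [- x], gives [2 * (1 - x ^+ 2)^-1]. *)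
Lemma expR_addN_le {R : realType} (x : R) :
  expR x + expR (- x) <= 2 * expR (2 * x ^+ 2).
Proof.
wlog x0 : x / 0 <= x.
  move=> H; have [/H//|/ltW x0] := leP 0 x.
  by have := H (- x); rewrite oppr_ge0 opprK sqrrN addrC; apply.
have [xh|xh] := leP (2^-1) x.
  have h1 : expR x <= expR (2 * x ^+ 2) by rewrite ler_expR; nra.
  have h2 : expR (- x) <= expR (2 * x ^+ 2) by rewrite ler_expR; nra.
  lra.
have inv_ge (y : R) : y < 1 -> expR y <= (1 - y)^-1.
  move=> y1; rewrite -[y in leLHS]opprK expRN lef_pV2 ?posrE ?expR_gt0//; last lra.
  exact: expR_ge1Dx.
have h1 : expR x <= (1 - x)^-1 by apply: inv_ge; lra.
have h2 : expR (- x) <= (1 + x)^-1.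
  by rewrite -[x in leRHS]opprK; apply: inv_ge; lra.
have y1 : 0 < 1 - x ^+ 2 by nra.
have h3 : (1 - x ^+ 2)^-1 <= expR (2 * x ^+ 2).
  apply: (@le_trans _ _ (1 + 2 * x ^+ 2)); last exact: expR_ge1Dx.
  have y4 : x ^+ 2 <= 4^-1 by nra.
  have y0 : 0 <= x ^+ 2 by apply: sqr_ge0.
  rewrite -[leLHS]mul1r ler_pdivrMr//; nra.
have E : (1 - x)^-1 + (1 + x)^-1 = 2 * (1 - x ^+ 2)^-1.
  by field; rewrite !lt0r_neq0//; lra.
lra.
Qed.

(** This is the independence of the signs: the exponential of the sum is a product over [T], and
    summing over all [e] distributes over it. *)
Lemma sum_expR_sign_sum {R : realType} {T : finType} (l : R) :
  \sum_(e : {ffun T -> bool}) expR (l * sign_sum R e [set: T]%SET) =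
  (expR l + expR (- l)) ^+ #|T|.
Proof.
rewrite -[RHS]prodr_const.
transitivity (\prod_(i : T) \sum_(b : bool) expR (l * (-1) ^+ b)); last first.
  by apply: eq_bigr => i _; rewrite big_bool/= expr1 expr0 mulrN mulr1 addrC.
rewrite bigA_distr_bigA/=; apply: eq_bigr => e _.
rewrite /sign_sum mulr_sumr expR_sum; apply: eq_bigl => i; exact: finset.in_setT.
Qed.

(** Chernoff's bound: [2 * l ^+ 2 * m - l * t] is least at [l = t / (4 * m)], with value
    [- (t ^+ 2 / (8 * m))]. The leading 2 accounts for the two tails. *)
Lemma card_large_signs_setT {R : realType} {T : finType} (t : R) :
  (0 < #|T|)%N -> 0 <= t ->
  #|large_signs t [set [set: T]]%SET|%:R <=
  2 * 2 ^+ #|T| * expR (- (t ^+ 2 / (8 * #|T|%:R))).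
Proof.
move=> T0 t0; set m : R := #|T|%:R.
have m0 : 0 < m by rewrite ltr0n.
pose l := t / (4 * m).
have l0 : 0 <= l by rewrite divr_ge0//; lra.
have cosh_le : (expR l + expR (- l)) ^+ #|T| <=
    2 ^+ #|T| * expR (2 * l ^+ 2 * m).
  rewrite /m expRM_natr -exprMn lerXn2r// ?nnegrE ?addr_ge0 ?mulr_ge0 ?expR_ge0//.
  exact: expR_addN_le.
have -> : expR (- (t ^+ 2 / (8 * m))) = expR (2 * l ^+ 2 * m) * expR (- (l * t)).
  by rewrite -expRD; congr expR; rewrite /l; field; rewrite gt_eqF.
rewrite mulrA -ler_pdivrMr ?expR_gt0// -expRN opprK.
apply: (@le_trans _ _ (\sum_(e : {ffun T -> bool})
   (expR (l * sign_sum R e [set: T]%SET) + expR (- l * sign_sum R e [set: T]%SET)))).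
  rewrite -sum1_card natr_sum mulr_suml big_mkcond/=.
  apply: ler_sum => e _; case: ifPn => [|_]; last by rewrite addr_ge0// expR_ge0.
  rewrite inE => /exists_inP[A /set1P -> tA]; rewrite mul1r.
  have lt_le : l * t <= l * `|sign_sum R e [set: T]%SET|.
    by rewrite ler_wpM2l// ltW.
  have [s0|s0] := leP 0 (sign_sum R e [set: T]%SET).
    rewrite (le_trans (y := expR (l * sign_sum R e [set: T]%SET)))//.
      by rewrite ler_expR -[X in _ <= l * X]ger0_norm.
    by rewrite lerDl expR_ge0.
  rewrite (le_trans (y := expR (- l * sign_sum R e [set: T]%SET)))//.
    by rewrite ler_expR mulNr -mulrN -[X in _ <= l * X]ltr0_norm.
  by rewrite lerDr expR_ge0.
rewrite big_split/= !sum_expR_sign_sum opprK [X in _ + X ^+ _]addrC.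
rewrite -mulrA mulr_natl mulr2n lerD//.
Qed.

(** * Summing the tails over all sets of coordinates *)

(** Two numbers that are at least 2 have a sum not exceeding their product. The empty product 1 is
    below 2, so the induction carries it as a separate case. *)
Lemma sum_le_prod {R : realType} {I : finType} (P : pred I) (b : I -> R) :
  (forall i, P i -> 2 <= b i) -> \sum_(i | P i) b i <= \prod_(i | P i) b i.
Proof.
move=> b2; suff : \sum_(i | P i) b i <= \prod_(i | P i) b i /\
    (\sum_(i | P i) b i = 0 /\ \prod_(i | P i) b i = 1 \/
     2 <= \prod_(i | P i) b i) by case.
elim/big_rec2 : _ => [|i s p /b2 bi [sp h]]; first by split; [lra|left].
case: h => [[-> ->]|p2]; first by split; [lra|right; lra].
by split; [nra|right; nra].
Qed.

Lemma prod_1D {R : realType} {I : finType} (y : I -> R) :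
  \prod_i (1 + y i) = 1 + \sum_(u : {set I} | u != finset.set0) \prod_(i in u) y i.
Proof.
under eq_bigr do rewrite addrC.
rewrite bigA_distr (bigD1 finset.set0)//=; congr (_ + _).
  by rewrite big1// => i _; rewrite finset.in_set0.
by apply: eq_bigr => u _; rewrite [RHS]big_mkcond.
Qed.

Lemma prod_1D_le {R : realType} {I : finType} (y : I -> R) (eta : R) :
  (forall i, 0 <= y i) -> \sum_i y i <= eta -> eta < 1 ->
  \prod_i (1 + y i) <= (1 - eta)^-1.
Proof.
move=> y0 s1 e1; apply: (@le_trans _ _ (expR eta)).
  apply: (@le_trans _ _ (expR (\sum_i y i))); last by rewrite ler_expR.
  rewrite expR_sum ler_prod// => i _.
  by rewrite addr_ge0//= expR_ge1Dx.
rewrite -[eta in leLHS]opprK expRN lef_pV2 ?posrE ?expR_gt0//; last lra.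
exact: expR_ge1Dx.
Qed.

Lemma partial_sums_bounded {R : realType} (f : nat -> R) :
  (forall j, 0 <= f j) -> (\sum_(0 <= j <oo) (f j)%:E < +oo)%E ->
  exists B : R, forall d : nat, \sum_(j < d) f j <= B.
Proof.
move=> f0 foo; exists (fine (\sum_(0 <= j <oo) (f j)%:E)%E) => d.
have h0 : (0 <= \sum_(0 <= j <oo) (f j)%:E)%E.
  by apply: nneseries_ge0 => j _ _; rewrite lee_fin.
rewrite -lee_fin fineK; last by rewrite ge0_fin_numE.
rewrite -sumEFin -(big_mkord xpredT (fun j => (f j)%:E)).
by apply: nneseries_lim_ge => j _; rewrite lee_fin.
Qed.

Lemma bounded_partial_sums_small {R : realType} (f : nat -> R) (B e : R) :
  (forall j, 0 <= f j) -> (forall d : nat, \sum_(j < d) f j <= B) -> 0 < e ->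
  exists j0 : nat, forall j, (j0 <= j)%N -> f j < e.
Proof.
move=> f0 fB e0.
have cf : cvgn (series f).
  apply: nondecreasing_is_cvgn.
    by apply/nondecreasing_series => j _.
  by exists B => _ [d _ <-]; rewrite /series/= big_mkord.
have := cvg_series_cvg_0 cf => /cvgrPdist_lt/(_ _ e0)[j0 _ h].
by exists j0 => j /h; rewrite sub0r normrN ger0_norm.
Qed.

(* Only finitely many gamma_j^-2 are below 2; replacing those by 2 costs a
   constant factor Q, after which a product of numbers >= 2 dominates their sum
   and the sum over u factors as a product over coordinates. *)
Lemma sum_expR_product_weight {R : realType} (gamma : nat -> R) (c : R) :
  (forall j, 0 <= gamma j) -> 0 < c ->
  (\sum_(0 <= j <oo) (exp_neg_inv_sqr c (gamma j))%:E < +oo)%E ->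
  exists K : R, 0 < K /\ forall d : nat,
    \sum_(u : {set 'I_d} | (u != finset.set0) && (product_weight gamma u != 0))
      2 ^+ #|u| * expR (- (K / product_weight gamma u ^+ 2)) < 4^-1.
Proof.
move=> g0 c0 /partial_sums_bounded[].
  by move=> j; rewrite /exp_neg_inv_sqr; case: ifP => // _; rewrite expR_ge0.
move=> B hB.
have f0 j : 0 <= exp_neg_inv_sqr c (gamma j).
  by rewrite /exp_neg_inv_sqr; case: ifP => // _; rewrite expR_ge0.
(* Below this threshold the square of [gamma j] is less than 1/2, so that [M j = 1] from [j0] on. *)
have [j0 hj0] := bounded_partial_sums_small _ _ _ f0 hB (expR_gt0 (- (2 * c))).
pose D j : R := Num.min (gamma j ^+ 2) 2^-1.
pose M j : R := Num.max 1 (2 * gamma j ^+ 2).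
have M1 j : 1 <= M j by rewrite le_max lexx.
have prodM_ge1 n (P : pred 'I_n) (h : 'I_n -> nat) :
    1 <= \prod_(j < n | P j) M (h j).
  by elim/big_rec : _ => // j s _; exact: mulr_ege1.
have gDM j : gamma j ^+ 2 = D j * M j.
  by rewrite /D /M; case: leP => h; case: leP => h'; nra.
have D0 j : 0 <= D j by rewrite le_min sqr_ge0/=; lra.
have D_gt0 j : gamma j != 0 -> 0 < D j.
  by move=> gj; rewrite lt_min exprn_even_gt0//=; lra.
have iD2 j : gamma j != 0 -> 2 <= (D j)^-1.
  move=> /D_gt0 Dj; rewrite -[2]invrK lef_pV2 ?posrE ?invr_gt0//.
  by rewrite ge_min lexx orbT.
have M_small j : (j0 <= j)%N -> M j = 1.
  move=> /hj0; rewrite /exp_neg_inv_sqr /M; case: eqP => [->|/eqP gj].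
    by move=> _; apply/max_idPl; rewrite expr0n/= mulr0; lra.
  have g2 : 0 < gamma j ^+ 2 by rewrite exprn_even_gt0.
  rewrite ltr_expR ltrN2 mulrC ltr_pM2l// -ltf_pV2 ?posrE ?invr_gt0// invrK => h.
  by apply/max_idPl; lra.
pose Q := \prod_(j < j0) M j.
have Q1 : 1 <= Q := prodM_ge1 _ _ _.
have wQ d (u : {set 'I_d}) :
    product_weight gamma u ^+ 2 <= Q * \prod_(j in u) D j.
  rewrite /product_weight -prodrXl; under eq_bigr do rewrite gDM.
  rewrite big_split/= mulrC ler_wpM2r ?prodr_ge0//.
  apply: (@le_trans _ _ (\prod_(j < d) M j)).
    rewrite [leRHS](bigID (mem u))/= ler_peMr ?prodr_ge0//.
      by move=> i _; rewrite (le_trans ler01).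
    exact: prodM_ge1.
  have {}E n : \prod_(j < n) M j <= \prod_(j < j0 + n) M j.
    rewrite addnC big_split_ord/= ler_peMr ?prodr_ge0//.
      by move=> i _; rewrite (le_trans ler01).
    exact: prodM_ge1.
  apply: (le_trans (E d)); rewrite big_split_ord/= [X in _ * X]big1 ?mulr1//.
  by move=> i _; rewrite M_small// leq_addr.
have B0 : 0 <= B by have := hB 0%N; rewrite big_ord0.
(* In [K], [Q] absorbs the factors [M], [c] keeps the summability, and [k] brings the sum of the
   [y j] down to 1/8, because [2 * B <= 8^-1 * expR (16 * B)]. *)
pose k := 8 * B.
pose K := Q * (c + k).
have k0 : 0 <= k by rewrite /k; lra.
exists K; split; first by rewrite mulr_gt0//; lra.
move=> d.
(* The factor 2 supplies [2 ^+ #|u|]; the value 0 at coordinates of weight zero matches the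
   exclusion of the sets [u] of weight zero. *)
pose y (j : 'I_d) := if gamma j == 0 then 0 else 2 * expR (- ((c + k) * (D j)^-1)).
have y0 j : 0 <= y j by rewrite /y; case: ifP => // _; rewrite mulr_ge0// expR_ge0.
have hy : \prod_j (1 + y j) <= (1 - 8^-1)^-1.
  apply: prod_1D_le => //; last lra.
  apply: (@le_trans _ _ ((2 * expR (- (2 * k))) * B)).
    apply: le_trans (ler_wpM2l _ (hB d)); last by rewrite mulr_ge0// expR_ge0.
    rewrite mulr_sumr ler_sum// => j _; rewrite /y /exp_neg_inv_sqr.
    case: eqP => [_|/eqP gj]; first by rewrite mulr0.
    (* [(D j)^-1] is at least 2, which serves the term in [k], and at least [gamma j ^- 2], which
       serves the term in [c]. *)
    rewrite -mulrA ler_wpM2l// -expRD ler_expR.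
    have := iD2 _ gj.
    have iDg : gamma j ^- 2 <= (D j)^-1.
      by rewrite lef_pV2 ?posrE ?D_gt0 ?exprn_even_gt0// ge_min lexx.
    nra.
  rewrite expRN mulrAC ler_pdivrMr ?expR_gt0//.
  have := expR_ge1Dx (2 * k); rewrite /k; lra.
apply: (@le_lt_trans _ _ (\sum_(u : {set 'I_d} | u != finset.set0) \prod_(j in u) y j)).
  rewrite big_mkcondr/=; apply: ler_sum => u _.
  case: ifPn => [w0|_]; last by rewrite prodr_ge0.
  have gu j : j \in u -> gamma j != 0.
    by move=> ju; move: w0; rewrite prodf_seq_neq0 => /allP/(_ j); rewrite mem_index_enum ju; apply.
  rewrite (eq_bigr (fun j : 'I_d => 2 * expR (- ((c + k) * (D j)^-1)))); last first.
    by move=> j /gu/negPf; rewrite /y => ->.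
  rewrite big_split/= prodr_const ler_wpM2l ?exprn_ge0//.
  rewrite -expR_sum ler_expR sumrN lerN2 -mulr_sumr.
  apply: (@le_trans _ _ ((c + k) * \prod_(j in u) (D j)^-1)).
    rewrite ler_wpM2l ?addr_ge0//; first exact: ltW.
    by apply: sum_le_prod => j /gu /iD2.
  rewrite /K prodfV ler_pdivlMr ?exprn_even_gt0//.
  have Du : 0 < \prod_(j in u) D j by apply: prodr_gt0 => j /gu /D_gt0.
  rewrite mulrAC ler_pdivrMr// (le_trans (ler_wpM2l _ (wQ d u))) ?addr_ge0//; first exact: ltW.
  lra.
(* One plus the sum is at most 8/7, which is below 5/4. *)
have := hy; rewrite prod_1D => h.
have : (1 - 8^-1 : R)^-1 < 1 + 4^-1 by rewrite -[ltLHS]mul1r ltr_pdivrMr; lra.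
lra.
Qed.

(** * Halving a point set by balanced signs *)

(** With all coordinates of the points below 1, the coordinates that [fill1] sets to 1 impose no
    condition, and only those in [u] count. *)
Definition half_open_cube {R : realType} {d : nat} : set (d.-tuple R) :=
  [set x | forall j, 0 <= tnth x j < 1].

Lemma half_open_cube_unit {R : realType} {d : nat} (x : d.-tuple R) :
  half_open_cube x -> unit_cube x.
Proof. by move=> hx j; have /andP[-> /ltW] := hx j. Qed.

Lemma unit_cube_fill1 {R : realType} {d : nat} (u : {set 'I_d}) (z : d.-tuple R) :
  unit_cube z -> unit_cube (fill1 u z).
Proof. by move=> hz j; rewrite tnth_mktuple; case: ifP; rewrite ?hz ?ler01 ?lexx. Qed.

(** The coordinates form a list, to allow an induction that adds one coordinate at a time. *)
Definition below {R : realType} {d : nat} {T : finType} (p : T -> d.-tuple R)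
    (s : seq 'I_d) (z : d.-tuple R) : {set T} :=
  [set i | all (fun j => tnth (p i) j < tnth z j) s]%SET.

Lemma indic_box0_fill1 {R : realType} {d : nat} {T : finType}
    (p : T -> d.-tuple R) (u : {set 'I_d}) (z : d.-tuple R) (i : T) :
  half_open_cube (p i) ->
  \1_(box0 (fill1 u z)) (p i) = (i \in below p (enum u) z)%:R :> R.
Proof.
move=> hp; rewrite indicE; congr (_%:R); congr nat_of_bool.
apply/idP/idP.
  rewrite inE/= => h; rewrite !inE; apply/allP => j; rewrite mem_enum => ju.
  by have := h j; rewrite tnth_mktuple ju => /andP[].
rewrite /below finset.inE => /allP h; rewrite inE => j; rewrite tnth_mktuple.
have /andP[-> h1] := hp j; case: ifPn => //= ju.
by apply: h; rewrite mem_enum.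
Qed.

Lemma chain_slabs {R : realType} {T : finType} (f : T -> R) :
  chain [set B : {set T} | `[< exists v, B = [set i | f i < v]%SET >]]%SET.
Proof.
move=> A B; rewrite !finset.inE => /asboolP[v ->] /asboolP[w ->].
have sub (a b : R) : a <= b -> [set i | f i < a]%SET \subset [set i | f i < b]%SET.
  by move=> ab; apply/fintype.subsetP => i; rewrite !inE => /lt_le_trans; apply.
by apply/orP; have [/sub|/ltW/sub] := leP v w; [left|right].
Qed.

(** Each coordinate intersects the family with one more chain of slabs and costs a factor 2. *)
Lemma card_large_signs_below {R : realType} {d : nat} {T : finType} (t : R)
    (p : T -> d.-tuple R) (s : seq 'I_d) :
  (#|[set e | `[< exists z, (t < `|sign_sum R e (below p s z)|)%R >]]%SET| <=
   2 ^ size s * #|large_signs t [set [set: T]]%SET|)%N.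
Proof.
(* The infinitely many corners [z] are replaced by a finite family [F] containing all their sets,
   which is what [large_signs] accepts. *)
suff [F [FE Fle]] : exists F : {set {set T}}, (forall z, below p s z \in F) /\
    (#|large_signs t F| <= 2 ^ size s * #|large_signs t [set [set: T]]%SET|)%N.
  apply: leq_trans Fle; apply/subset_leq_card/fintype.subsetP => e.
  rewrite !finset.inE => /asboolP[z tz]; apply/exists_inP.
  by exists (below p s z).
elim: s => [|j s [F [FE Fle]]].
  exists [set [set: T]]%SET; split; last by rewrite mul1n.
  by move=> z; apply/set1P/setP => i; rewrite !inE.
exists [set A :&: B | A in F, B in
  [set B : {set T} | `[< exists v, B = [set i | tnth (p i) j < v]%SET >]]]%SET.
split.
  move=> z; apply/imset2P; exists (below p s z) [set i | tnth (p i) j < tnth z j]%SET => //.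
    by rewrite finset.inE; apply/asboolP; exists (tnth z j).
  by apply/setP => i; rewrite !inE/= andbC.
rewrite (leq_trans (card_large_signs_chain _ _ _ (chain_slabs _)))//=.
by rewrite expnS -mulnA leq_mul2l.
Qed.

Lemma product_weight_ge0 {R : realType} (gamma : nat -> R) {d : nat}
    (u : {set 'I_d}) :
  (forall j, 0 <= gamma j) -> 0 <= product_weight gamma u.
Proof. by move=> g0; apply: prodr_ge0. Qed.

(** Union bound: each [u] of nonzero weight excludes at most [2 * 2 ^+ m] times its summand of sign
    vectors for [a], and as many for [b]. A sum below 1/4 thus excludes fewer than [2 ^+ m] in
    total. *)
Lemma exists_balanced_signs {R : realType} (gamma : nat -> R) (C : R) (d m : nat)
    (a b : 'I_m -> d.-tuple R) :
  (forall j, 0 <= gamma j) -> 0 <= C -> (0 < m)%N ->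
  \sum_(u : {set 'I_d} | (u != finset.set0) && (product_weight gamma u != 0))
    2 ^+ #|u| * expR (- (C ^+ 2 / 8 / product_weight gamma u ^+ 2)) < 4^-1 ->
  exists e : {ffun 'I_m -> bool}, forall p, p = a \/ p = b ->
    forall (u : {set 'I_d}) z, u != finset.set0 ->
    product_weight gamma u * `|sign_sum R e (below p (enum u) z)| <=
    C * Num.sqrt m%:R.
Proof.
move=> g0 C0 m0 hsum.
pose t (u : {set 'I_d}) := C * Num.sqrt m%:R / product_weight gamma u.
pose P (u : {set 'I_d}) := (u != finset.set0) && (product_weight gamma u != 0).
pose bad (p : 'I_m -> d.-tuple R) (u : {set 'I_d}) : {set {ffun 'I_m -> bool}} :=
  [set e | `[< exists z, t u < `|sign_sum R e (below p (enum u) z)| >]]%SET.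
have bad_le p u : P u -> #|bad p u|%:R <=
    2 * 2 ^+ m * (2 ^+ #|u| * expR (- (C ^+ 2 / 8 / product_weight gamma u ^+ 2))).
  move=> /andP[_ wu].
  have t0 : 0 <= t u.
    by rewrite divr_ge0 ?mulr_ge0 ?sqrtr_ge0// product_weight_ge0.
  have := card_large_signs_setT (T := 'I_m) (t u).
  rewrite card_ord => /(_ m0 t0) h.
  have := card_large_signs_below (t u) p (enum u).
  rewrite -cardE -(ler_nat R) natrM natrX => /le_trans -> //.
  rewrite mulrCA ler_wpM2l ?exprn_ge0// (le_trans h)//.
  rewrite ler_wpM2l ?mulr_ge0 ?exprn_ge0// ler_expR lerN2.
  rewrite /t expr_div_n exprMn sqr_sqrtr//.
  have m0' : (m%:R : R) != 0 by rewrite pnatr_eq0 -lt0n.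
  rewrite le_eqVlt; apply/orP; left; apply/eqP; field.
  by rewrite wu m0'.
have [e eN] : exists e, forall u, P u -> e \notin bad a u :|: bad b u.
  apply: contrapT => /forallNP H.
  have H' e : exists2 u, P u & e \in bad a u :|: bad b u.
    apply: contrapT => K; apply: (H e) => u Pu; apply/negP => eu.
    by apply: K; exists u.
  have : (2 ^ m <= \sum_(u | P u) (#|bad a u| + #|bad b u|))%N.
    have -> : (2 ^ m = \sum_(e : {ffun 'I_m -> bool}) 1)%N.
      by rewrite sum1_card card_ffun card_bool card_ord.
    under [leqRHS]eq_bigr do rewrite -!sum1_card [X in (X + _)%N]big_mkcond
      [X in (_ + X)%N]big_mkcond -big_split/=.
    rewrite exchange_big/=; apply: leq_sum => e _.
    have [u Pu] := H' e; rewrite (bigD1 u)//= finset.in_setU.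
    by case: (e \in bad a u); case: (e \in bad b u).
  apply/negP; rewrite -ltnNge -(ltr_nat R) natrX natr_sum.
  apply: (@le_lt_trans _ _ (\sum_(u | P u) 4 * 2 ^+ m *
    (2 ^+ #|u| * expR (- (C ^+ 2 / 8 / product_weight gamma u ^+ 2))))).
    apply: ler_sum => u Pu; rewrite natrD.
    by have := bad_le a u Pu; have := bad_le b u Pu; lra.
  rewrite -mulr_sumr mulrAC -ltr_pdivlMr ?exprn_gt0// divff ?expf_neq0//.
  by rewrite /P; lra.
exists e => p pab u z u0.
have [->|w0] := eqVneq (product_weight gamma u) 0.
  by rewrite mul0r mulr_ge0// sqrtr_ge0.
rewrite mulrC -ler_pdivlMr ?lt0r ?w0 ?product_weight_ge0// leNgt.
have := eN u; rewrite /P u0 w0 => /(_ isT); rewrite finset.in_setU negb_or.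
move=> /andP[ea eb]; apply/negP => h.
have [/negP] : e \notin bad p u by case: pab => ->.
by apply; rewrite finset.inE; apply/asboolP; exists z.
Qed.

(** The indicator at a kept point is half the sum of those at its pair, plus half their signed
    difference. The volumes cancel, which leaves the difference of two balanced sums divided by
    [2 * m%:R]. *)
Lemma local_discrepancy_halving {R : realType} (gamma : nat -> R) (C : R)
    (d m : nat) (p : 'I_(m + m) -> d.-tuple R) :
  (forall j, 0 <= gamma j) -> 0 <= C -> (0 < m)%N ->
  \sum_(u : {set 'I_d} | (u != finset.set0) && (product_weight gamma u != 0))
    2 ^+ #|u| * expR (- (C ^+ 2 / 8 / product_weight gamma u ^+ 2)) < 4^-1 ->
  (forall i, half_open_cube (p i)) ->
  exists c : 'I_m -> d.-tuple R, (forall i, half_open_cube (c i)) /\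
    forall (u : {set 'I_d}) z, u != finset.set0 ->
    product_weight gamma u *
      `|local_discrepancy c (fill1 u z) - local_discrepancy p (fill1 u z)| <=
    C / Num.sqrt m%:R.
Proof.
move=> g0 C0 m0 hsum hp.
pose a i := p (lshift m i); pose b i := p (rshift m i).
have [e he] := exists_balanced_signs gamma C d m a b g0 C0 m0 hsum.
pose c i := if e i then b i else a i.
have hc i : half_open_cube (c i) by rewrite /c; case: ifP => _; apply: hp.
exists c; split=> // u z u0.
have w0 := product_weight_ge0 gamma u g0.
have m0' : 0 < (m%:R : R) by rewrite ltr0n.
have signE q : sign_sum R e (below q (enum u) z) =
    \sum_i (-1) ^+ e i * (i \in below q (enum u) z)%:R.
  rewrite /sign_sum big_mkcond; apply: eq_bigr => i _.
  by case: ifP => _; rewrite ?mulr1 ?mulr0.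
have -> : local_discrepancy c (fill1 u z) - local_discrepancy p (fill1 u z) =
    (2 * m%:R)^-1 * (sign_sum R e (below a (enum u) z) -
                     sign_sum R e (below b (enum u) z)).
  rewrite /local_discrepancy big_split_ord/= natrD.
  rewrite (eq_bigr (fun i => (i \in below c (enum u) z)%:R)); last first.
    by move=> i _; rewrite -indic_box0_fill1.
  rewrite [in X in _ - X](eq_bigr (fun i => (i \in below a (enum u) z)%:R)); last first.
    by move=> i _; rewrite -indic_box0_fill1//; apply: hp.
  rewrite [X in _ - (_ * (_ + X) - _)](eq_bigr (fun i => (i \in below b (enum u) z)%:R)); last first.
    by move=> i _; rewrite -indic_box0_fill1//; apply: hp.
  rewrite !signE.
  have -> : \sum_i (i \in below c (enum u) z)%:R = 2^-1 *
    (\sum_i (i \in below a (enum u) z)%:R + \sum_i (i \in below b (enum u) z)%:R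
     + \sum_i (-1) ^+ e i * (i \in below a (enum u) z)%:R
     - \sum_i (-1) ^+ e i * (i \in below b (enum u) z)%:R) :> R.
    rewrite -big_split -sumrN -!big_split/= mulr_sumr; apply: eq_bigr => i _.
    rewrite /below !finset.inE /c; case: (e i); rewrite ?expr1 ?expr0; lra.
  by field; rewrite !lt0r_neq0 ?addr_gt0.
rewrite normrM ger0_norm ?invr_ge0 ?mulr_ge0//.
have ha := he a (or_introl erefl) u z u0.
have hb := he b (or_intror erefl) u z u0.
set sa := sign_sum R e (below a _ _) in ha *.
set sb := sign_sum R e (below b _ _) in hb *.
have h : product_weight gamma u * `|sa - sb| <= 2 * (C * Num.sqrt m%:R).
  rewrite (le_trans (ler_wpM2l w0 (ler_normB _ _)))// mulrDr; lra.
rewrite mulrCA invfM.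
have sm : 0 < Num.sqrt m%:R :> R by rewrite sqrtr_gt0.
have -> : C / Num.sqrt m%:R = 2^-1 * m%:R^-1 * (2 * (C * Num.sqrt m%:R)) :> R.
  rewrite -[in m%:R^-1](sqr_sqrtr (ltW m0')); field.
  by rewrite gt_eqF.
by rewrite ler_wpM2l ?mulr_ge0 ?invr_ge0.
Qed.

(** With [q] the inverse square root of 2, the halving that leaves [2 ^ j * N] points costs
    [q ^+ j * (C / Num.sqrt N%:R)]. Since [1 - q] is at least 1/4,
    [q ^+ j <= 4 * (q ^+ j - q ^+ j.+1)], and the costs telescope. Tying [n] by an equation lets the
    index type follow the induction on [k]. *)
Lemma local_discrepancy_descent {R : realType} (gamma : nat -> R) (C : R)
    (d N k : nat) :
  (forall j, 0 <= gamma j) -> 0 <= C -> (0 < N)%N ->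
  \sum_(u : {set 'I_d} | (u != finset.set0) && (product_weight gamma u != 0))
    2 ^+ #|u| * expR (- (C ^+ 2 / 8 / product_weight gamma u ^+ 2)) < 4^-1 ->
  forall n (p : 'I_n -> d.-tuple R) (beta : R), n = (2 ^ k * N)%N ->
  (forall i, half_open_cube (p i)) ->
  (forall (u : {set 'I_d}) z, u != finset.set0 -> unit_cube z ->
    product_weight gamma u * `|local_discrepancy p (fill1 u z)| <= beta) ->
  exists x : 'I_N -> d.-tuple R, (forall i, half_open_cube (x i)) /\
    forall (u : {set 'I_d}) z, u != finset.set0 -> unit_cube z ->
    product_weight gamma u * `|local_discrepancy x (fill1 u z)| <=
    beta + 4 * (1 - (Num.sqrt 2)^-1 ^+ k) * (C / Num.sqrt N%:R).
Proof.
move=> g0 C0 N0 hsum; set q : R := (Num.sqrt 2)^-1.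
have q0 : 0 < q by rewrite invr_gt0 sqrtr_gt0.
have q34 : q <= 3 / 4.
  have s2 : (Num.sqrt 2 : R) ^+ 2 = 2 by rewrite sqr_sqrtr.
  have := sqrtr_ge0 (2 : R); have : q * Num.sqrt 2 = 1 by rewrite mulVf// sqrtr_eq0 -ltNge.
  nra.
have sqrtX k' : Num.sqrt (2 ^+ k') = Num.sqrt 2 ^+ k' :> R.
  elim: k' => [|k' IH]; first by rewrite sqrtr1.
  by rewrite !exprS sqrtrM// IH.
have CN : 0 <= C / Num.sqrt N%:R by rewrite divr_ge0// sqrtr_ge0.
elim: k => [|k IHk] n p beta nE hp hbeta.
  rewrite mul1n in nE; subst n; exists p; split=> // u z u0 z1.
  by rewrite expr0 subrr mulr0 mul0r addr0 hbeta.
rewrite expnS mul2n -addnn mulnDl in nE; subst n.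
have m0 : (0 < 2 ^ k * N)%N by rewrite muln_gt0 expn_gt0.
have [c [hc cp]] := local_discrepancy_halving gamma C d _ p g0 C0 m0 hsum hp.
have step (u : {set 'I_d}) z : u != finset.set0 -> unit_cube z ->
    product_weight gamma u * `|local_discrepancy c (fill1 u z)| <=
    beta + q ^+ k * (C / Num.sqrt N%:R).
  move=> u0 z1; have w0 := product_weight_ge0 gamma u g0.
  have E : C / Num.sqrt (2 ^ k * N)%:R = q ^+ k * (C / Num.sqrt N%:R).
    by rewrite natrM natrX sqrtrM ?exprn_ge0// sqrtX invfM exprVn mulrCA.
  rewrite -E; apply: le_trans (lerD (hbeta _ _ u0 z1) (cp _ z u0)).
  by rewrite -mulrDr ler_wpM2l// addrC -[X in `|X| <= _](subrK (local_discrepancy p (fill1 u z))) ler_normD.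
have [x [hx xb]] := IHk _ c _ erefl hc step.
exists x; split=> // u z u0 z1; apply: (le_trans (xb u z u0 z1)).
rewrite exprS; have qk : 0 <= q ^+ k by rewrite exprn_ge0// ltW.
rewrite -addrA lerD2l -mulrDl ler_wpM2r//; nra.
Qed.

(** * The fine grid from which the halving starts *)

(** The count is the ceiling of [y]. *)
Lemma count_lt_itv {R : realType} (M : nat) (y : R) :
  0 <= y <= M%:R -> y <= \sum_(j < M) (j%:R < y)%R%:R <= y + 1.
Proof.
move=> /andP[y0 yM].
have full n : n%:R <= y -> \sum_(j < n) (j%:R < y)%R%:R = n%:R :> R.
  move=> ny; rewrite (eq_bigr (fun=> 1)); first by rewrite sumr_const card_ord.
  by move=> j _; rewrite (lt_le_trans _ ny)// ltr_nat.
elim: M yM => [|M IH] yM.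
  by rewrite mulr0n in yM; rewrite big_ord0; apply/andP; split; lra.
rewrite big_ord_recr/=; have [h|h] := leP y M%:R.
  by rewrite addr0 IH.
rewrite full; last exact: ltW.
by rewrite -natr1 in yM; rewrite mulr1n; apply/andP; split; lra.
Qed.

(** Factors are exchanged one at a time; the others lie in [0, 1] and do not enlarge the error. *)
Lemma normr_prodB_le {R : realType} {I : finType} (a b : I -> R) :
  (forall i, 0 <= a i <= 1) -> (forall i, 0 <= b i <= 1) ->
  `|\prod_i a i - \prod_i b i| <= \sum_i `|a i - b i|.
Proof.
move=> ha hb.
suff [] : `|\prod_i a i - \prod_i b i| <= \sum_i `|a i - b i| /\
    (0 <= \prod_i b i <= 1) by [].
apply: (big_rec3 (fun pa pb s => `|pa - pb| <= s /\ (0 <= pb <= 1))).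
  by rewrite subrr normr0 ler01 !lexx.
move=> i pa pb s _ [IH /andP[b0 b1]].
have /andP[ai0 ai1] := ha i; have /andP[bi0 bi1] := hb i.
split; last by rewrite mulr_ge0// mulr_ile1.
have -> : a i * pa - b i * pb = (a i - b i) * pb + a i * (pa - pb) by ring.
rewrite (le_trans (ler_normD _ _))// lerD//.
  by rewrite normrM ler_piMr// ger0_norm.
by rewrite normrM (le_trans _ IH)// ler_piMl// ger0_norm.
Qed.

Definition grid_point {R : realType} {d M : nat} (f : {ffun 'I_d -> 'I_M}) :
    d.-tuple R :=
  [tuple (f j)%:R / M%:R | j < d].

Lemma half_open_cube_grid_point {R : realType} {d M : nat}
    (f : {ffun 'I_d -> 'I_M}) : half_open_cube (grid_point f : d.-tuple R).
Proof.
move=> j; rewrite tnth_mktuple divr_ge0//=.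
have M0 : (0 < M)%N by apply: leq_ltn_trans (ltn_ord (f j)).
by rewrite ltr_pdivrMr ?ltr0n// mul1r ltr_nat.
Qed.

(** The proportion of grid points in a box is a product of one-dimensional proportions, each within
    [M%:R^-1] of the side length. Repeating the grid [N] times leaves it unchanged and prepares a
    size that halves down to [N]. *)
Lemma local_discrepancy_grid {R : realType} (d N M : nat) :
  (0 < N)%N -> (0 < M)%N ->
  exists p : 'I_(N * M ^ d) -> d.-tuple R,
    (forall i, half_open_cube (p i)) /\
    forall z, unit_cube z -> `|local_discrepancy p z| <= d%:R / M%:R.
Proof.
move=> N0 M0; pose T := ('I_N * {ffun 'I_d -> 'I_M})%type.
have TE : #|{: T}| = (N * M ^ d)%N by rewrite card_prod card_ffun !card_ord.
rewrite -TE; exists (fun i => grid_point (enum_val i).2); split.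
  by move=> i; exact: half_open_cube_grid_point.
move=> z z1; rewrite /local_discrepancy lebesgue_n_box0//=.
have M0' : 0 < (M%:R : R) by rewrite ltr0n.
have N0' : 0 < (N%:R : R) by rewrite ltr0n.
pose S j : R := \sum_(k < M) (k%:R < M%:R * tnth z j)%R%:R.
have SM j : `|S j / M%:R - tnth z j| <= M%:R^-1 /\ 0 <= S j / M%:R <= 1.
  have /andP[zj0 zj1] := z1 j.
  have /count_lt_itv/andP[] : 0 <= M%:R * tnth z j <= M%:R.
    by rewrite mulr_ge0//= ler_piMr.
  rewrite -/(S j) => S1 S2; split.
    have -> : S j / M%:R - tnth z j = (S j - M%:R * tnth z j) / M%:R.
      by field; rewrite lt0r_neq0.
    rewrite normrM [X in _ * X]ger0_norm ?invr_ge0//.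
    by rewrite ler_piMl ?invr_ge0// ger0_norm; lra.
  rewrite divr_ge0//=; last by apply: sumr_ge0 => k _; rewrite ler0n.
  rewrite ler_pdivrMr// mul1r -[in leRHS](card_ord M) -sumr_const.
  by apply: ler_sum => k _; case: ltP.
have -> : (#|{: T}|%:R)^-1 * \sum_(i < #|{: T}|)
    \1_(box0 z) (grid_point (enum_val i).2) = \prod_j (S j / M%:R) :> R.
  rewrite -(big_enum_val (A := {: T}) (fun i => \1_(box0 z) (grid_point i.2)))/=.
  rewrite -(pair_bigA _ (fun (n : 'I_N) f => \1_(box0 z) (grid_point f)))/=.
  rewrite sumr_const card_ord.
  have -> : \sum_(f : {ffun 'I_d -> 'I_M}) \1_(box0 z) (grid_point f) =
      \prod_j S j :> R.
    rewrite /S bigA_distr_bigA/=; apply: eq_bigr => f _.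
    have [h|h] := boolP [forall j, (f j)%:R < M%:R * tnth z j].
      rewrite big1; last by move=> j _; rewrite (forallP h j).
      rewrite indicE mem_set// => j; rewrite tnth_mktuple divr_ge0//=.
      by rewrite ltr_pdivrMr// mulrC (forallP h j).
    move: (h); rewrite negb_forall => /existsP[j jN].
    rewrite (bigD1 j)//= (negPf jN) mul0r indicE memNset// => /(_ j).
    rewrite tnth_mktuple ltr_pdivrMr// => /andP[_].
    by rewrite mulrC (negPf jN).
  rewrite TE natrM natrX big_split/= prodr_const card_ord exprVn -mulr_natr.
  have := lt0r_neq0 (exprn_gt0 d M0'); move: (_ ^+ d) => Md Md0.
  by field; rewrite Md0 lt0r_neq0.
apply: (le_trans (normr_prodB_le _ _ _ _)) => //.
  by move=> j; have [] := SM j.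
apply: (@le_trans _ _ (\sum_(j < d) M%:R^-1)).
  by apply: ler_sum => j _; have [] := SM j.
by rewrite sumr_const card_ord -[leLHS]mulr_natl.
Qed.

(** * The bound for all [N] and [d], and strong tractability *)

Lemma discrepancy_bound {R : realType} (gamma : nat -> R) :
  (forall j, 0 <= gamma j) ->
  (exists2 c : R, 0 < c &
     (\sum_(0 <= j <oo) (exp_neg_inv_sqr c (gamma j))%:E < +oo)%E) ->
  exists C : R, 0 < C /\ forall N d : nat, (0 < N)%N ->
    exists x : 'I_N -> d.-tuple R, (forall n, unit_cube (x n)) /\
      (weighted_star_discrepancy gamma x <= (C / Num.sqrt N%:R)%:E)%E.
Proof.
move=> g0 [c c0 /(sum_expR_product_weight _ _ g0 c0)[K [K0 hK]]].
pose C := Num.sqrt (8 * K).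
have C0 : 0 <= C by apply: sqrtr_ge0.
have CK : C ^+ 2 / 8 = K by rewrite sqr_sqrtr; [field|rewrite mulr_ge0// ltW].
(* The 1 pays for the grid, and [4 * C] for all the halvings. *)
exists (1 + 4 * C); split; first by lra.
move=> N d N0.
have sN : 0 < Num.sqrt N%:R :> R by rewrite sqrtr_gt0 ltr0n.
(* [W] may grow with [d], but it only affects the fineness [2 ^ r] of the grid, not the final
   constant. *)
pose W := \sum_(u : {set 'I_d}) product_weight gamma u.
have wW (u : {set 'I_d}) : product_weight gamma u <= W.
  rewrite /W (bigD1 u)//= lerDl sumr_ge0// => v _.
  exact: product_weight_ge0.
have W0 : 0 <= W by apply: sumr_ge0 => u _; exact: product_weight_ge0.
have [r hr] : exists r, W * d%:R * Num.sqrt N%:R <= 2 ^+ r :> R.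
  by eexists; exact: ltW (upper_nthrootP (leqnn _)).
(* A power of two per axis makes the size [N] times a power of two, reached from [N] by [r * d]
   doublings. *)
have [p [hp pb]] := local_discrepancy_grid (R := R) d N (2 ^ r) N0
  (expn_gt0 2 r).
have sizeE : (N * (2 ^ r) ^ d = 2 ^ (r * d) * N)%N by rewrite expnM mulnC.
have start (u : {set 'I_d}) z : u != finset.set0 -> unit_cube z ->
    product_weight gamma u * `|local_discrepancy p (fill1 u z)| <=
    (Num.sqrt N%:R)^-1.
  move=> u0 z1; apply: (@le_trans _ _ (W * (d%:R / 2 ^+ r))).
    rewrite ler_pM ?product_weight_ge0//.
    by have := pb _ (unit_cube_fill1 u z z1); rewrite natrX.
  by rewrite mulrA ler_pdivrMr ?exprn_gt0// [leRHS]mulrC ler_pdivlMr.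
have sumlt := hK d; rewrite -CK in sumlt.
have [x [hx xb]] := local_discrepancy_descent gamma C d N (r * d) g0 C0 N0
  sumlt _ p _ sizeE hp start.
exists x; split; first by move=> n; apply: half_open_cube_unit.
apply: ge_ereal_sup => _ [z z1 <-]; rewrite lee_fin.
have CN : 0 <= C / Num.sqrt N%:R by rewrite divr_ge0// ltW.
apply: bigmax_le => [|u u0]; first by rewrite divr_ge0 ?ltW//; lra.
apply: (le_trans (xb u z u0 z1)); rewrite [leRHS]mulrDl mul1r lerD2l.
have q0 : 0 <= (Num.sqrt 2)^-1 ^+ (r * d) :> R by rewrite exprn_ge0// invr_ge0 sqrtr_ge0.
rewrite -[leRHS]mulrA ler_wpM2r//; lra.
Qed.

Theorem theorem3 (R : realType) (gamma : nat -> R)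
    (gamma_ge0 : forall j, 0 <= gamma j)
    (gamma_sum : exists2 c : R, 0 < c &
       (\sum_(0 <= j <oo) (exp_neg_inv_sqr c (gamma j))%:E < +oo)%E) :
  (exists C : R, forall N d : nat, (0 < N)%N -> (0 < d)%N ->
     exists x : 'I_N -> d.-tuple R,
       (forall n, unit_cube (x n)) /\
       (weighted_star_discrepancy gamma x <= (C / Num.sqrt N%:R)%:E)%E) /\
  (strongly_tractable gamma /\
   (strong_tractability_exponent gamma <= 2%:E)%E).
Proof.
have [C [C0 hC]] := discrepancy_bound gamma gamma_ge0 gamma_sum.
have trac : tractability_bound gamma (C ^+ 2 + 1) 2.
  move=> d e d0 /andP[e0 e1].
  pose M := C ^+ 2 / e ^+ 2.
  have M0 : 0 < M by rewrite divr_gt0// exprn_gt0.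
  (* [N >= M] gives [C / Num.sqrt N%:R <= e], while [N <= M + 1] is at most [(C ^+ 2 + 1) / e ^+ 2]
     because [e < 1]. *)
  pose N := (Num.truncn M).+1.
  have MN : M <= N%:R by apply/ltW/truncnS_gt.
  have NM : N%:R <= M + 1.
    by rewrite -natr1 lerD2r truncn_le ltW.
  have [x [hx xb]] := hC N d isT.
  apply: (@le_trans _ _ N%:R%:E).
    apply: ereal_inf_lbound; exists N => //; split=> //.
    exists x; split=> //; apply: (le_trans xb).
    rewrite lee_fin ler_pdivrMr ?sqrtr_gt0 ?ltr0n//.
    rewrite -ler_pdivrMl// -[leLHS]ger0_norm; last by rewrite mulr_ge0 ?invr_ge0// ltW.
    rewrite -sqrtr_sqr ler_wsqrtr// exprMn exprVn mulrC//.
  rewrite lee_fin (le_trans NM)// powRN powR_mulrn ?(ltW e0)//.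
  by rewrite mulrDl mul1r lerD2l invf_ge1 ?exprn_gt0// exprn_ile1 ?(ltW e0) ?(ltW e1).
split; first by exists C => N d N0 _; apply: hC.
have C1 : 0 <= C ^+ 2 + 1 by rewrite addr_ge0// sqr_ge0.
split; first by exists (C ^+ 2 + 1), 2.
by apply: ereal_inf_lbound; exists 2 => //; split=> //; exists (C ^+ 2 + 1).
Qed.
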